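(* Let $n\ge 3$ and let $P_n(x)=x^n+a_{n-2}x^{n-2}+\cdots+a_1x+a_0$ be a real monic polynomial of degree $n$ with no $x^{n-1}$ term. Set $P_{n-1}(x)=\frac1nP_n'(x)$, define $R_{n-2}$ by $P_n(x)=\frac{x}{n}P_n'(x)-R_{n-2}(x)=xP_{n-1}(x)-R_{n-2}(x)$, and put $R^0_{n-2}(x)=R_{n-2}(x)+a_0$. Assume $P_{n-1}$ has $n-1$ distinct real roots $\alpha_1^{(n-1)}<\cdots<\alpha_{n-1}^{(n-1)}$. For $n$ even, if $$\sup_{k\in\{1,\ldots,\frac{n-2}{2}\}}R_{n-2}(\alpha_{2k}^{(n-1)})<0<\inf_{k\in\{0,\ldots,\frac{n-2}{2}\}}R_{n-2}(\alpha_{2k+1}^{(n-1)})$$ and $$a_0\in\left]\sup_{k\in\{1,\ldots,\frac{n-2}{2}\}}R^0_{n-2}(\alpha_{2k}^{(n-1)})\,;\,\inf_{k\in\{0,\ldots,\frac{n-2}{2}\}}R^0_{n-2}(\alpha_{2k+1}^{(n-1)})\right[,$$ then $P_n$ has $n$ distinct real roots. For $n$ odd, if $$\sup_{k\in\{0,\ldots,\frac{n-3}{2}\}}R_{n-2}(\alpha_{2k+1}^{(n-1)})<0<\inf_{k\in\{1,\ldots,\frac{n-1}{2}\}}R_{n-2}(\alpha_{2k}^{(n-1)})$$ and $$a_0\in\left]\sup_{k\in\{0,\ldots,\frac{n-3}{2}\}}R^0_{n-2}(\alpha_{2k+1}^{(n-1)})\,;\,\inf_{k\in\{1,\ldots,\frac{n-1}{2}\}}R^0_{n-2}(\alpha_{2k}^{(n-1)})\right[,$$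 then $P_n$ has $n$ distinct real roots.
   Context: Standing conventions of the paper: polynomials are monic with real coefficients and no $x^{n-1}$ term. Here $R_{n-2}(x)=xP_{n-1}(x)-P_n(x)$ has constant term $-a_0$, so $R^0_{n-2}$ is the polynomial $R_{n-2}$ with its constant term removed (it does not depend on $a_0$). The notation $]u;v[$ denotes the open interval. *)

(* Defs.v *)
From HB Require Import structures.
From mathcomp Require Export all_boot all_order all_algebra.
From mathcomp Require Export boolp classical_sets reals.

Set Implicit Arguments.
Unset Strict Implicit.
Unset Printing Implicit Defensive.

Import Order.TTheory GRing.Theory Num.Theory.
Local Open Scope ring_scope.

Section Polynomials.
Variables (R : realType) (n : nat) (a : nat -> R).

(* Only the coefficients a 0, ..., a (n - 2) are used. *)
Definition Pn : {poly R} := 'X^n + \sum_(i < n.-1) a i *: 'X^i.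

Definition Pn1 : {poly R} := n%:R^-1 *: Pn^`().

Definition Rn2 : {poly R} := 'X * Pn1 - Pn.

Definition R0n2 : {poly R} := Rn2 + (a 0%N)%:P.

End Polynomials.

(* The roots are numbered from 1: only alpha 1, ..., alpha m are constrained. *)
Definition increasing_roots (R : realType) (m : nat) (p : {poly R})
    (alpha : nat -> R) : Prop :=
  (forall i, (1 <= i <= m)%N -> root p (alpha i)) /\
  (forall i j, (1 <= i)%N -> (i < j)%N -> (j <= m)%N -> alpha i < alpha j).

Definition has_distinct_real_roots (R : realType) (m : nat) (p : {poly R}) :
    Prop :=
  exists s : m.-tuple R, uniq s /\ (forall x, root p x <-> x \in s).

Definition nat_range (l u : nat) : set nat :=
  [set k : nat | (l <= k <= u)%N]%classic.

(* Main.v *)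
Require Import Defs.
From HB Require Import structures.
From mathcomp Require Import all_boot all_order all_algebra.
From mathcomp Require Import boolp classical_sets reals.
From mathcomp Require Import zify lra polyrcf.

Set Implicit Arguments.
Unset Strict Implicit.
Unset Printing Implicit Defensive.

Import Order.TTheory GRing.Theory Num.Theory.
Local Open Scope classical_set_scope.
Local Open Scope ring_scope.

(* At a root x of P_(n-1) we have P_n(x) = - R_(n-2)(x), so the hypotheses say
   that (-1)^(n-i) P_n(alpha_i) > 0 for 1 <= i <= n-1. As P_n is monic of degree
   n, the same alternation continues at -oo (i = 0) and at +oo (i = n), and the
   intermediate value theorem yields a root in each of the n gaps. *)

(** The index range is finite, so the image is bounded above: the sum of all [|f i|] with [i <= u]
    is a crude bound that dominates each value. *)
Lemma le_sup_nat_range (R : realType) (l u k : nat) (f : nat -> R) :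
  (l <= k <= u)%N -> f k <= sup [set f i | i in nat_range l u].
Proof.
move=> kP; apply: ub_le_sup; last by exists k.
exists (\sum_(i < u.+1) `|f i|) => _ [i /= /andP[_ iu] <-].
rewrite (le_trans (ler_norm _))//.
by rewrite (bigD1 (Ordinal (iu : i < u.+1)%N)) //= lerDl sumr_ge0.
Qed.

Lemma ge_inf_nat_range (R : realType) (l u k : nat) (f : nat -> R) :
  (l <= k <= u)%N -> inf [set f i | i in nat_range l u] <= f k.
Proof.
move=> kP; rewrite /inf lerNl image_comp.
exact: (@le_sup_nat_range R l u k (fun i => - f i)).
Qed.

(** Each sign change gives a root strictly inside its gap. The gaps are disjoint, so these [n] roots
    are distinct, and the degree leaves room for no other. *)
Lemma has_distinct_real_roots_sign_changes (R : realType) (n : nat)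
    (p : {poly R}) (b : nat -> R) :
  size p = n.+1 ->
  (forall i, (i < n)%N -> b i < b i.+1) ->
  (forall i, (i < n)%N -> p.[b i] * p.[b i.+1] < 0) ->
  has_distinct_real_roots n p.
Proof.
move=> sp blt bsign.
have p0 : p != 0 by rewrite -size_poly_eq0 sp.
(* The value 0 for [i >= n] is a dummy that makes the choice function total. *)
have /choice[x xP] : forall i, exists x : R,
    (i < n)%N -> [/\ b i < x, x < b i.+1 & root p x].
  move=> i; case: (ltnP i n) => [ltin|_]; last by exists 0.
  have [x xi rx] := poly_ivtoo (ltW (blt i ltin)) (bsign i ltin).
  by exists x => _; rewrite !(itvP xi).
have ble i j : (i <= j <= n)%N -> b i <= b j.
  elim: j => [|j IH]; first by rewrite leqn0 => /andP[/eqP ->].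
  case/andP; rewrite leq_eqVlt ltnS => /orP[/eqP -> //|ij jn].
  by rewrite (le_trans (IH _)) ?ij ?(ltnW jn) // ltW ?blt.
have xlt i j : (i < j < n)%N -> x i < x j.
  move=> /andP[ij jn]; have [_ xi _] := xP i (ltn_trans ij jn).
  have [xj _ _] := xP j jn.
  by rewrite (lt_trans xi)// (le_lt_trans _ xj)// ble// ij ltnW.
pose s := [tuple x i | i < n].
have us : uniq s.
  rewrite map_inj_uniq ?enum_uniq // => i j xij; apply/val_inj => /=.
  case: (ltngtP i j) => // lij.
    by have := xlt i j; rewrite lij ltn_ord xij ltxx => /(_ isT).
  by have := xlt j i; rewrite lij ltn_ord xij ltxx => /(_ isT).
have rs : all (root p) s.
  by apply/allP => _ /mapP[i _ ->]; have [] := xP i (ltn_ord i).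
exists s; split=> // y; split=> [ry|]; last exact: (allP rs).
(* A root [y] outside [s] would give [n + 1] distinct roots, as many as [size p]. *)
apply: contraT => ys; have := @max_poly_roots _ p (y :: s) p0.
by rewrite /= ry rs ys us size_map size_enum_ord sp ltnn => /(_ isT isT).
Qed.

Lemma has_distinct_real_roots_alternating (R : realType) (n : nat)
    (p : {poly R}) (alpha : nat -> R) :
  p \is monic -> size p = n.+1 -> (1 < n)%N ->
  (forall i, (0 < i)%N -> (i.+1 < n)%N -> alpha i < alpha i.+1) ->
  (forall i, (0 < i < n)%N -> 0 < (-1) ^+ (n + i) * p.[alpha i]) ->
  has_distinct_real_roots n p.
Proof.
move=> /monicP lp sp n1 alt asign.
have [hi hiP] : exists x, forall y, x <= y -> 0 < p.[y].
  have [|x xP] := @poly_pinfty_gt_lc _ p; first by rewrite lp.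
  by exists x => y /xP; rewrite lp; apply: lt_le_trans.
have [lo loP] : exists x, forall y, y <= x -> 0 < (-1) ^+ n * p.[y].
  (* The reflected polynomial (-1)^n p(-x) is again monic, so its positivity near +oo gives the sign
     of [p] near -oo. *)
  have lq : lead_coef ((-1) ^+ n *: (p \Po -'X)) = 1.
    rewrite lead_coefZ lead_coef_comp ?size_polyN ?size_polyX //.
    by rewrite lead_coefN lead_coefX lp sp mul1r -exprMn mulN1r opprK expr1n.
  have [|x xP] := @poly_pinfty_gt_lc _ ((-1) ^+ n *: (p \Po -'X)).
    by rewrite lq.
  exists (- x) => y; rewrite lerNr => /xP.
  by rewrite lq hornerZ horner_comp !hornerE opprK; apply: lt_le_trans.
(* The interior nodes are the [alpha i]. The two outer nodes lie beyond both the sign threshold and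
   the extreme [alpha]; the shift by 1 makes the order strict. *)
pose b i := if i == 0%N then Num.min lo (alpha 1%N) - 1
  else if (i < n)%N then alpha i else Num.max hi (alpha n.-1) + 1.
have bsign i : (i <= n)%N -> 0 < (-1) ^+ (n + i) * p.[b i].
  rewrite /b; case: eqP => [-> _|/eqP i0 lein].
    rewrite addn0; apply: loP.
    by rewrite lerBlDr (@le_trans _ _ lo) ?ge_min ?lexx ?lerDl.
  case: ltnP => [ltin|lenn]; first by apply: asign; rewrite lt0n i0.
  have -> : i = n by apply/eqP; rewrite eqn_leq lein.
  rewrite -signr_odd addnn odd_double expr0 mul1r; apply: hiP.
  by rewrite (@le_trans _ _ (Num.max hi (alpha n.-1))) ?le_max ?lexx ?lerDl.
apply: (@has_distinct_real_roots_sign_changes _ _ _ b) => // i lin.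
  rewrite /b /= lin; case: eqP => [->|/eqP i0].
    by rewrite n1 ltrBlDr (@le_lt_trans _ _ (alpha 1%N)) ?ge_min
      ?lexx ?orbT ?ltrDl.
  case: ltnP => [ltin|lenn]; first by apply: alt; rewrite // lt0n.
  have -> : i = n.-1 by lia.
  by rewrite (@le_lt_trans _ _ (Num.max hi (alpha n.-1))) ?le_max
    ?lexx ?orbT ?ltrDl.
(* The factors (-1)^(n+i) and (-1)^(n+i+1) are opposite, so the two values of [p] have opposite
   signs. *)
have := bsign i (ltnW lin); have := bsign i.+1 lin.
rewrite addnS exprS -mulrA mulN1r oppr_gt0.
move: p.[b i] p.[b i.+1] => u v.
by rewrite -signr_odd; case: odd; rewrite ?(expr1, expr0); nra.
Qed.

Lemma size_monic_Pn (R : realType) (n : nat) (a : nat -> R) :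
  size (Pn n a) = n.+1 /\ Pn n a \is monic.
Proof.
have slt : (size (\sum_(i < n.-1) a i *: 'X^i : {poly R})%R
            < size ('X^n : {poly R})%R)%N.
  rewrite size_polyXn ltnS (leq_trans _ (leq_pred n)) // -poly_def.
  exact: size_poly.
by split; rewrite /Pn ?monicE (size_polyDl, lead_coefDl) //
  ?size_polyXn ?lead_coefXn.
Qed.

Lemma horner_Rn2_root (R : realType) (n : nat) (a : nat -> R) (x : R) :
  root (Pn1 n a) x -> (Rn2 n a).[x] = - (Pn n a).[x].
Proof.
by move=> /rootP r; rewrite /Rn2 hornerD hornerM hornerN r mulr0 add0r.
Qed.

Theorem theorem1 (R : realType) (n : nat) (a : nat -> R) (alpha : nat -> R)
  (hn : (3 <= n)%N)
  (halpha : increasing_roots (n - 1) (Pn1 n a) alpha) :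
  (~~ odd n ->
     sup [set (Rn2 n a).[alpha (2 * k)%N] | k in nat_range 1 ((n - 2) %/ 2)]
       < 0
       < inf [set (Rn2 n a).[alpha (2 * k + 1)%N] | k in nat_range 0 ((n - 2) %/ 2)] ->
     a 0%N \in
       `]sup [set (R0n2 n a).[alpha (2 * k)%N] | k in nat_range 1 ((n - 2) %/ 2)],
         inf [set (R0n2 n a).[alpha (2 * k + 1)%N] | k in nat_range 0 ((n - 2) %/ 2)][ ->
     has_distinct_real_roots n (Pn n a))
  /\
  (odd n ->
     sup [set (Rn2 n a).[alpha (2 * k + 1)%N] | k in nat_range 0 ((n - 3) %/ 2)]
       < 0
       < inf [set (Rn2 n a).[alpha (2 * k)%N] | k in nat_range 1 ((n - 1) %/ 2)] ->
     a 0%N \in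
       `]sup [set (R0n2 n a).[alpha (2 * k + 1)%N] | k in nat_range 0 ((n - 3) %/ 2)],
         inf [set (R0n2 n a).[alpha (2 * k)%N] | k in nat_range 1 ((n - 1) %/ 2)][ ->
     has_distinct_real_roots n (Pn n a)).
Proof.
have [ra ia] := halpha.
have [sP mP] := size_monic_Pn n a.
(* One sign condition covers both parities of [n]: [Rn2] is negative at [alpha i] when [i] has the
   parity of [n], and positive otherwise. *)
have main : (forall i, (0 < i < n)%N ->
    (-1) ^+ (n + i) * (Rn2 n a).[alpha i] < 0) ->
    has_distinct_real_roots n (Pn n a).
  move=> h; apply: (@has_distinct_real_roots_alternating _ _ _ alpha) => //.
  - exact: leq_trans hn.
  - by move=> i i0 lin; apply: ia => //; lia.
  - move=> i iP; have := h i iP.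
    by rewrite horner_Rn2_root ?mulrN ?oppr_lt0 //; apply: ra; lia.
split=> n2 /andP[hsup hinf] _; apply: main => i iP;
    rewrite -signr_odd oddD ?n2 ?(negbTE n2) /=; case: (boolP (odd i)) => io;
    rewrite ?expr0 ?expr1 ?mul1r ?mulN1r ?oppr_lt0.
(* In all four cases the witness is [k = i./2]. The supremum bounds the indices with the parity of
   [n], the infimum the others. *)
- have -> : i = (2 * i./2 + 1)%N by lia.
  apply: (lt_le_trans hinf).
  by apply: (@ge_inf_nat_range _ _ _ _ (fun k => _.[alpha (2 * k + 1)%N])); lia.
- have -> : i = (2 * i./2)%N by lia.
  apply: le_lt_trans hsup.
  by apply: (@le_sup_nat_range _ _ _ _ (fun k => _.[alpha (2 * k)%N])); lia.
- have -> : i = (2 * i./2 + 1)%N by lia.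
  apply: le_lt_trans hsup.
  by apply: (@le_sup_nat_range _ _ _ _ (fun k => _.[alpha (2 * k + 1)%N])); lia.
- have -> : i = (2 * i./2)%N by lia.
  apply: (lt_le_trans hinf).
  by apply: (@ge_inf_nat_range _ _ _ _ (fun k => _.[alpha (2 * k)%N])); lia.
Qed.
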